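(* Consider the target–partaker–guardian system written out in the context and its trivial constant steady state $(\overline{u},0,\overline{w})$, where $\overline{w}=\frac{1}{|\Omega|}\int_\Omega w_0\,dx$ and $\overline{u}$ (assumed to exist) is a solution $s=\overline{u}$ of $-s\,g_1(s,0,\overline{w})+h_1(s)=0$. Consider the two inequalities $$\overline{u}\,f(\overline{u},0,\overline{w})+g_2(\overline{u},0,\overline{w})>h_2(0),$$ $$g_1(\overline{u},0,\overline{w})+\overline{u}\,\frac{\partial g_1}{\partial u}(\overline{u},0,\overline{w})+\min\left\{\frac{\overline{u}\,\overline{w}\,\chi_2(\overline{u})}{D_w}\,\frac{\partial g_1}{\partial w}(\overline{u},0,\overline{w}),\ 0\right\}>\frac{dh_1}{du}(\overline{u}).$$ If both inequalities are satisfied, then the steady state $(\overline{u},0,\overline{w})$ of the system is locally asymptotically stable. If at least one of the two inequalities is false, then the steady state $(\overline{u},0,\overline{w})$ is unstable.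
   Context: Domain: $\Omega\subset\mathbb{R}^2$ is a bounded domain with piecewise smooth boundary $\partial\Omega$, and $\mathbf{n}$ is the outward unit normal. Target–partaker–guardian system, for unknowns $u,v,w$ on $\Omega\times(0,T]$ ($T$ may be infinite): $$\begin{aligned} u_t&=D_u\Delta u+u\big[\gamma v f(u,v,w)-g_1(u,v,w)\big]+h_1(u),\\ v_t&=\nabla\cdot\big[D_v\nabla v-v\chi_1(u)\nabla u\big]+v\big[-uf(u,v,w)-g_2(u,v,w)+h_2(v)\big],\\ w_t&=\nabla\cdot\big[D_w\nabla w-w\chi_2(u)\nabla u\big], \end{aligned}$$ with $\partial u/\partial\mathbf{n}=\partial v/\partial\mathbf{n}=\partial w/\partial\mathbf{n}=0$ on $\partial\Omega$ and $u(\cdot,0)=u_0\ge0$, $v(\cdot,0)=v_0\ge0$, $w(\cdot,0)=w_0\ge0$ in $\Omega$. Here $D_u,D_v,D_w,\gamma$ are positive constants, $f$ is non-negative, $f,g_1,g_2$ are continuously differentiable functions of $(u,v,w)$ on $[0,\infty)^3$, and $h_1,h_2,\chi_1,\chi_2$ are continuously differentiable on $[0,\infty)$. The partial derivatives $\partial g_1/\partial u$, $\partial g_1/\partial w$ are with respect to the first and third arguments of $g_1$. Stability of the steady state is understood in the sense of linear stability analysis: perturb the steady state as $(\overline u+\epsilon\hat u,\ \epsilon\hat v,\ \overline w+\epsilon\hat w)$ with $0<\epsilon\ll1$, linearize, and consider the growth rates $\sigma$ of modes $(C_1,C_2,C_3)e^{\sigma t+ik\cdot x}$ with wave vectors $k$,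 $|k|>0$.
   Formalization: Instability is claimed only when at least one of the two inequalities is strictly reversed; if one is an equality and the other is not reversed, every mode with |k|>0 decays, so the claim ''false implies unstable'' fails in that case. *)

(* Defs.v *)
From HB Require Import structures.
From mathcomp Require Import all_boot all_order all_algebra complex.
From mathcomp Require Import all_classical all_reals all_analysis.
Import Order.TTheory GRing.Theory Num.Theory numFieldNormedType.Exports.

Set Implicit Arguments.
Unset Strict Implicit.
Unset Printing Implicit Defensive.

Local Open Scope classical_set_scope.
Local Open Scope ring_scope.

Section Domain.
Variable R : realType.
Implicit Types (Omega : set (R * R)) (c : R -> R * R) (w : R * R -> R).

(* A C^1 arc with nowhere vanishing velocity, simple except that it may close
   up.  The derivative is two-sided: the parametrisation is defined past the
   end points of [0, 1]. *)
Definition regular_arc c :=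
  [/\ forall s, 0 <= s <= 1 -> derivable c s 1,
      {within `[0, 1]%classic, continuous (derive1 c)},
      forall s, 0 <= s <= 1 -> derive1 c s != 0 &
      forall s t, 0 <= s -> s < t -> t <= 1 -> c s = c t -> s = 0 /\ t = 1].

Definition piecewise_smooth_boundary Omega :=
  exists (n : nat) (c : 'I_n -> R -> R * R),
    [/\ forall i, regular_arc (c i),
        forall i j s t, i != j -> 0 <= s <= 1 -> 0 <= t <= 1 ->
          c i s = c j t -> (s = 0 \/ s = 1) /\ (t = 0 \/ t = 1) &
        closure Omega `\` Omega° =
          \bigcup_(i in [set: 'I_n]) (c i @` `[0, 1]%classic)].

Definition bounded_domain Omega :=
  [/\ Omega !=set0, open Omega, connected Omega & bounded_set Omega].

Definition mean Omega w : R :=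
  (\int[(@lebesgue_measure R \x @lebesgue_measure R)%E]_(x in Omega) w x)
  / fine ((@lebesgue_measure R \x @lebesgue_measure R)%E Omega).

End Domain.

Section Regularity.
Variable R : realType.
Implicit Types (h : R -> R) (g : R -> R -> R -> R).

Definition pd1 g (a b c : R) : R := derive1 (fun s => g s b c) a.
Definition pd2 g (a b c : R) : R := derive1 (fun s => g a s c) b.
Definition pd3 g (a b c : R) : R := derive1 (fun s => g a b s) c.

(* Functions on [0, oo) and [0, oo)^3 are represented by total functions;
   being C^1 on these closed sets means being C^1 on an open neighbourhood of
   them, so that the derivatives at boundary points (such as v = 0) are the
   library's two-sided ones.  Nothing is assumed off the neighbourhood. *)
Definition C1_nonneg h :=
  exists U : set R,
    [/\ open U, forall a, 0 <= a -> U a,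
        forall a, U a -> derivable h a 1 &
        forall a, U a -> {for a, continuous (derive1 h)}].

Definition C1_nonneg3 g :=
  exists U : set (R * R * R),
    [/\ open U,
        forall a b c, 0 <= a -> 0 <= b -> 0 <= c -> U (a, b, c),
        forall a b c, U (a, b, c) ->
          [/\ derivable (fun s => g s b c) a 1,
              derivable (fun s => g a s c) b 1 &
              derivable (fun s => g a b s) c 1] &
        forall p, U p ->
          [/\ {for p, continuous (fun q : R * R * R => pd1 g q.1.1 q.1.2 q.2)},
              {for p, continuous (fun q : R * R * R => pd2 g q.1.1 q.1.2 q.2)} &
              {for p, continuous (fun q : R * R * R => pd3 g q.1.1 q.1.2 q.2)}]].

End Regularity.

Section Operators.
Variable R : realType.
Implicit Types (p : R * R -> R) (F : R * R -> R * R) (u : R -> R * R -> R).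

Definition ddx1 p (x : R * R) : R := derive1 (fun s => p (s, x.2)) x.1.
Definition ddx2 p (x : R * R) : R := derive1 (fun s => p (x.1, s)) x.2.
Definition grad p (x : R * R) : R * R := (ddx1 p x, ddx2 p x).
Definition diverg F (x : R * R) : R :=
  ddx1 (fun y => (F y).1) x + ddx2 (fun y => (F y).2) x.
Definition laplacian p : R * R -> R := diverg (grad p).
Definition ddt u (t : R) (x : R * R) : R := derive1 (fun s => u s x) t.

End Operators.

Record tpg_system (R : realType) := TPG {
  D_u : R; D_v : R; D_w : R; gamma : R;
  f : R -> R -> R -> R; g1 : R -> R -> R -> R; g2 : R -> R -> R -> R;
  h1 : R -> R; h2 : R -> R; chi1 : R -> R; chi2 : R -> R }.

Definition tpg_admissible (R : realType) (S : tpg_system R) :=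
  [/\ [/\ 0 < D_u S, 0 < D_v S, 0 < D_w S & 0 < gamma S],
      forall a b c, 0 <= a -> 0 <= b -> 0 <= c -> 0 <= f S a b c,
      [/\ C1_nonneg3 (f S), C1_nonneg3 (g1 S) & C1_nonneg3 (g2 S)] &
      [/\ C1_nonneg (h1 S), C1_nonneg (h2 S), C1_nonneg (chi1 S) &
          C1_nonneg (chi2 S)]].

Section LinearStability.
Variables (R : realType) (S : tpg_system R).
Implicit Types (u v w : R -> R * R -> R) (t : R) (x k : R * R).

(* Left-hand side minus right-hand side of each equation of the system; the
   triple (u, v, w) solves the system where the three residuals vanish. *)
Definition residual_u u v w t x : R :=
  ddt u t x -
  (D_u S * laplacian (u t) x
   + u t x * (gamma S * v t x * f S (u t x) (v t x) (w t x)
              - g1 S (u t x) (v t x) (w t x))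
   + h1 S (u t x)).

Definition residual_v u v w t x : R :=
  ddt v t x -
  (diverg (fun y => D_v S *: grad (v t) y
                    - (v t y * chi1 S (u t y)) *: grad (u t) y) x
   + v t x * (- u t x * f S (u t x) (v t x) (w t x)
              - g2 S (u t x) (v t x) (w t x) + h2 S (v t x))).

Definition residual_w u w t x : R :=
  ddt w t x -
  diverg (fun y => D_w S *: grad (w t) y
                   - (w t y * chi2 S (u t y)) *: grad (u t) y) x.

Definition perturb (s eps : R) (p : R -> R * R -> R) : R -> R * R -> R :=
  fun t x => s + eps * p t x.

(* (p, q, r) solves the linearisation at the constant state (us, vs, ws) iff
   the first-order term in eps of every residual of the perturbed state
   vanishes on Omega x (0, oo). *)
Definition solves_linearized (Omega : set (R * R)) (us vs ws : R)
    (p q r : R -> R * R -> R) :=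
  forall t x, 0 < t -> Omega x ->
  [/\ is_derive (0 : R) 1 (fun eps => residual_u
        (perturb us eps p) (perturb vs eps q) (perturb ws eps r) t x) 0,
      is_derive (0 : R) 1 (fun eps => residual_v
        (perturb us eps p) (perturb vs eps q) (perturb ws eps r) t x) 0 &
      is_derive (0 : R) 1 (fun eps => residual_w
        (perturb us eps p) (perturb ws eps r) t x) 0].

Definition cexp (z : R[i]) : R[i] :=
  Complex (expR (complex.Re z) * cos (complex.Im z))
          (expR (complex.Re z) * sin (complex.Im z)).

Definition mode (C sigma : R[i]) k t x : R[i] :=
  C * cexp (sigma * t%:C%C + Complex 0 (k.1 * x.1 + k.2 * x.2)).

(* The linearised system has real coefficients, so a complex-valued triple
   solves it iff its real and imaginary parts do. *)
Definition growth_rate (Omega : set (R * R)) (us vs ws : R) k (sigma : R[i]) :=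
  exists C1 C2 C3 : R[i],
    [/\ ~ [/\ C1 = 0, C2 = 0 & C3 = 0],
        solves_linearized Omega us vs ws
          (fun t x => complex.Re (mode C1 sigma k t x))
          (fun t x => complex.Re (mode C2 sigma k t x))
          (fun t x => complex.Re (mode C3 sigma k t x)) &
        solves_linearized Omega us vs ws
          (fun t x => complex.Im (mode C1 sigma k t x))
          (fun t x => complex.Im (mode C2 sigma k t x))
          (fun t x => complex.Im (mode C3 sigma k t x))].

Definition asymptotically_stable (Omega : set (R * R)) (us vs ws : R) :=
  forall k sigma, k != 0 -> growth_rate Omega us vs ws k sigma ->
    complex.Re sigma < 0.

(* If one of the two stability inequalities degenerates to an equality and the
   other is not reversed, every mode with k != 0 still has Re sigma < 0, so the
   state is not unstable. *)
Definition unstable (Omega : set (R * R)) (us vs ws : R) :=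
  exists k sigma, [/\ k != 0, growth_rate Omega us vs ws k sigma &
    0 < complex.Re sigma].

End LinearStability.

(* Main.v *)
Require Import Defs.
From HB Require Import structures.
From mathcomp Require Import all_boot all_order all_algebra complex.
From mathcomp Require Import all_classical all_reals all_analysis.
From mathcomp Require Import ring lra.
Import Order.TTheory GRing.Theory Num.Theory numFieldNormedType.Exports.

(** Substituting a mode [(C1, C2, C3) exp(sigma t + i k.x)] with [K = |k|^2]
into the linearised system leaves three equations for [(C1, C2, C3)]:
[(sigma + D_u K - a) C1 - b C2 + c C3 = 0], [(sigma + D_v K - l) C2 = 0] and
[(sigma + D_w K) C3 = m K C1], with [a, b, c] the partial derivatives of the
reaction terms of [u] ([c] up to sign), [l] the linear growth rate of [v] and
[m = wbar chi2(ubar)].  Hence either [sigma = l - D_v K], or [sigma = - D_w K],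
or [sigma] is a root of
[(sigma + D_u K - a) (sigma + D_w K) + c m K].  The two inequalities say
[l < 0] and [a < min (c m / D_w) 0]; they make both coefficients of this
quadratic positive for every [K > 0].  If one of them is reversed, long waves
(small [K]) provide a positive [sigma]: for [a > 0] the quadratic is negative
at [a / 2], for [c m < a D_w] at [0]. *)

Set Implicit Arguments.
Unset Strict Implicit.
Unset Printing Implicit Defensive.

Local Open Scope classical_set_scope.
Local Open Scope ring_scope.

Section Calculus.
Variable R : realType.
Implicit Types (f g B : R -> R) (x y a b c : R).

Lemma is_deriveD_fun f g x a b : is_derive x 1 f a -> is_derive x 1 g b ->
  is_derive x 1 (fun s => f s + g s) (a + b).
Proof. exact: is_deriveD. Qed.

Lemma is_deriveB_fun f g x a b : is_derive x 1 f a -> is_derive x 1 g b ->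
  is_derive x 1 (fun s => f s - g s) (a - b).
Proof. exact: is_deriveB. Qed.

Lemma is_deriveM_fun f g x a b : is_derive x 1 f a -> is_derive x 1 g b ->
  is_derive x 1 (fun s => f s * g s) (f x * b + g x * a).
Proof. exact: is_deriveM. Qed.

Lemma is_deriveN_fun f x a : is_derive x 1 f a ->
  is_derive x 1 (fun s => - f s) (- a).
Proof. exact: is_deriveN. Qed.

Lemma is_deriveMl_fun f x a b : is_derive x 1 f a ->
  is_derive x 1 (fun s => b * f s) (b * a).
Proof. exact: is_deriveZ. Qed.

Lemma is_derive_affine a b x : is_derive x 1 (fun s => a + s * b) b.
Proof.
have -> : (fun s => a + s * b) = (fun s => cst a s + b * id s).
  by apply/funext => s /=; rewrite mulrC.
have := is_deriveD_fun (is_derive_cst a x 1) (is_deriveMl_fun b (is_derive_id x 1)).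
by rewrite add0r mulr1.
Qed.

Lemma is_derive_mulr x b : is_derive x 1 (fun s => s * b) b.
Proof.
have := is_derive_affine 0 b x; congr (is_derive _ _ _ _).
by apply/funext => s; rewrite add0r.
Qed.

Lemma is_derive_derive1 f x a : is_derive x 1 f a -> derive1 f x = a.
Proof. by move=> fa; rewrite derive1E derive_val. Qed.

Lemma is_derive_continuous f x a : is_derive x 1 f a -> {for x, continuous f}.
Proof. by case=> /derivable1_diffP/differentiable_continuous. Qed.

Lemma is_derive_ideal f B : {for 0, continuous B} ->
  (\forall e \near (0 : R), f e = e * B e) -> is_derive (0 : R) 1 f (B 0).
Proof.
move=> cB fB.
suff : is_derive (0 : R) 1 (fun e => e * B e) (B 0).
  by apply: near_eq_is_derive; near=> e; rewrite (near fB e).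
have h0 : (fun h : R => h^-1 *: (((fun e => e * B e) \o shift 0) (h *: 1) -
    (fun e => e * B e) 0)) @ 0^' --> B 0.
  apply: (@cvg_trans _ (B @ 0^')); last first.
    by apply: cvg_trans cB; apply: cvg_app; exact: cvg_within.
  apply: near_eq_cvg; near=> h.
  have hn0 : h != 0 by near: h; exact: nbhs_dnbhs_neq.
  rewrite /= /shift /= mul0r subr0 addr0 [h *: 1]mulr1 /GRing.scale /=.
  by rewrite mulKf.
apply: DeriveDef; first by apply/cvg_ex; exists (B 0).
by apply: cvg_lim.
Unshelve. all: by end_near. Qed.

Lemma cvg0_mul (p : R) : (fun e : R => e * p) @ (0 : R) --> (0 : R).
Proof. by rewrite -[X in _ --> X](mul0r p); exact: mulrr_continuous. Qed.

Lemma cvg0_norm_mul (p : R) : (fun e : R => `|e * p|) @ (0 : R) --> (0 : R).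
Proof.
by rewrite -[X in _ --> X](normr0 R); apply: cvg_norm; exact: cvg0_mul.
Qed.

Lemma near0_mul (p d : R) : 0 < d -> \forall e \near (0 : R), `|e * p| < d.
Proof. by move=> d0; have := cvgr_lt _ (@cvg0_norm_mul p) _ d0; exact. Qed.

(* The mean value theorem on [0, e * p], for a function that itself moves
   with e. *)
Lemma is_derive_increment (F : R -> R -> R) (p : R) :
  (\forall z \near ((0, 0) : R * R), derivable (F z.1) z.2 1) ->
  {for ((0, 0) : R * R), continuous (fun z : R * R => derive1 (F z.1) z.2)} ->
  is_derive (0 : R) 1 (fun e => F e (e * p) - F e 0) (p * derive1 (F 0) 0).
Proof.
move=> dF cF.
have /nbhs_ballP[d /= d0 Hd] := dF.
have thP (e : R) : exists th : R, 0 <= th <= 1 /\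
    (`|e| < d -> `|e * p| < d ->
     F e (e * p) - F e 0 = e * (p * derive1 (F e) (th * (e * p)))).
  have [ed|ed] := pselect (`|e| < d /\ `|e * p| < d); last first.
    by exists 0; rewrite lexx ler01; split => // e1 e2; case: ed.
  have [e1 e2] := ed.
  have dth (t : R) : 0 <= t <= 1 -> derivable (F e) (t * (e * p)) 1.
    move=> /andP[t0 t1]; apply: (Hd (e, t * (e * p))).
    split; rewrite /ball /= sub0r normrN //.
    by rewrite normrM ger0_norm// (le_lt_trans _ e2)// ler_piMl.
  have iD (t : R) : 0 <= t <= 1 -> is_derive t 1 (fun t => F e (t * (e * p)))
      (derive1 (F e) (t * (e * p)) * (e * p)).
    move=> t01; apply: (@is_derive1_comp _ (F e) (fun t => t * (e * p))).
      by rewrite derive1E; apply/derivableP/dth.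
    exact: is_derive_mulr.
  have [|||t] := @MVT_segment R (fun t => F e (t * (e * p)))
     (fun t => derive1 (F e) (t * (e * p)) * (e * p)) 0 1.
  - exact: ler01.
  - move=> t; rewrite in_itv/= => /andP[t0 t1].
    by apply: iD; rewrite !ltW.
  - apply: derivable_within_continuous => t; rewrite in_itv/= => t01.
    by case: (iD t t01).
  - rewrite in_itv/= => t01; rewrite subr0 mulr1 mul1r mul0r => E.
    by exists t; split=> // _ _; rewrite E; ring.
have [th thE] := choice thP.
have -> : p * derive1 (F 0) 0 =
    (fun e => p * derive1 (F e) (th e * (e * p))) 0 by rewrite /= mul0r mulr0.
apply: (@is_derive_ideal _ (fun e => p * derive1 (F e) (th e * (e * p))));
  last first.
  near=> e; apply: (thE e).2.
    by rewrite -(mulr1 e); near: e; exact: near0_mul.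
  by near: e; exact: near0_mul.
rewrite /prop_for /continuous_at mul0r mulr0.
have cz : (fun e : R => (e, th e * (e * p))) @ (0 : R) --> ((0, 0) : R * R).
  have ep0 : (fun e : R => th e * (e * p)) @ (0 : R) --> (0 : R).
    apply/norm_cvg0P; apply: (squeeze_cvgr _ (cvg_cst 0) (@cvg0_norm_mul p)).
    apply: nearW => e; rewrite normr_ge0 /= normrM.
    have [/andP[t0 t1] _] := thE e.
    by rewrite ger0_norm// ler_piMl.
  exact: (cvg_pair cvg_id ep0).
have cFz := cvg_comp _ _ cz cF.
exact: (cvgM (cvg_cst p) cFz).
Unshelve. all: by end_near. Qed.

End Calculus.

Section Line.
Variable R : realType.

Lemma derive1_shiftl (f : R -> R) (a s : R) :
  derive1 (fun s => f (a + s)) s = derive1 f (a + s).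
Proof.
by rewrite /derive1; under eq_fun do rewrite addrCA.
Qed.

Lemma derivable_shiftl (f : R -> R) (a s : R) :
  derivable f (a + s) 1 -> derivable (fun s => f (a + s)) s 1.
Proof.
move=> df; have -> : (fun s => f (a + s)) = f \o (fun s => a + s * 1).
  by apply/funext => x /=; rewrite mulr1.
have [] // := @is_derive1_comp _ f (fun s => a + s * 1) s ('D_1 f (a + s)) 1 _ _.
  by rewrite mulr1; exact/derivableP.
exact: is_derive_affine.
Qed.

Lemma is_derive_line (g : R -> R -> R -> R) (a b c p q r : R) :
  C1_nonneg3 g -> 0 <= a -> 0 <= b -> 0 <= c ->
  is_derive (0 : R) 1 (fun e => g (a + e * p) (b + e * q) (c + e * r))
    (p * pd1 g a b c + q * pd2 g a b c + r * pd3 g a b c).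
Proof.
move=> [U [oU Uge dU cU]] a0 b0 c0.
have Uabc := Uge _ _ _ a0 b0 c0.
have cst0 (x : R) : (fun _ : R * R => x) @ (0 : R, 0 : R) --> x by exact: cvg_cst.
have fst0 (x y : R) : (fun z : R * R => x + z.1 * y) @ (0 : R, 0 : R) --> x.
  rewrite -[X in _ --> X]addr0.
  exact: (cvgD (@cst0 x) (cvg_comp _ _ cvg_fst (@cvg0_mul R y))).
have snd0 (x : R) : (fun z : R * R => x + z.2) @ (0 : R, 0 : R) --> x.
  rewrite -[X in _ --> X]addr0.
  exact: (cvgD (@cst0 x) cvg_snd).
have nU (L1 L2 L3 : R * R -> R) : L1 @ (0 : R, 0 : R) --> a ->
    L2 @ (0 : R, 0 : R) --> b -> L3 @ (0 : R, 0 : R) --> c ->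
    (\forall z \near ((0, 0) : R * R), U (L1 z, L2 z, L3 z)) /\
    (fun z => (L1 z, L2 z, L3 z)) @ (0 : R, 0 : R) --> (a, b, c).
  move=> h1 h2 h3; have h := cvg_pair (cvg_pair h1 h2) h3; split; last exact: h.
  by apply: h; exact: (open_nbhs_nbhs (conj oU Uabc)).
pose F1 e s := g (a + s) (b + e * q) (c + e * r).
pose F2 e s := g a (b + s) (c + e * r).
pose F3 (e s : R) := g a b (c + s).
have [cU1 cU2 cU3] := cU _ Uabc.
have [N1 C1] := nU _ _ _ (snd0 a) (fst0 b q) (fst0 c r).
have [N2 C2] := nU _ _ _ (cst0 a) (snd0 b) (fst0 c r).
have [N3 C3] := nU _ _ _ (cst0 a) (cst0 b) (snd0 c).
have D1 : is_derive (0 : R) 1 (fun e => F1 e (e * p) - F1 e 0) (p * pd1 g a b c).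
  have -> : pd1 g a b c = derive1 (F1 0) 0.
    by rewrite [RHS](@derive1_shiftl (fun s => g s _ _)) addr0 !mul0r !addr0.
  apply: is_derive_increment.
    near=> z; have [|h _ _] := dU (a + z.2) (b + z.1 * q) (c + z.1 * r).
      by near: z.
    exact: (@derivable_shiftl (fun s => g s _ _)).
  rewrite /prop_for /continuous_at [X in _ --> X]/=.
  rewrite [X in _ --> X](@derive1_shiftl (fun s => g s _ _)) addr0 !mul0r !addr0.
  under eq_fun do rewrite [X in X _]/= (@derive1_shiftl (fun s => g s _ _)).
  exact: (cvg_comp _ _ C1 cU1).
have D2 : is_derive (0 : R) 1 (fun e => F2 e (e * q) - F2 e 0) (q * pd2 g a b c).
  have -> : pd2 g a b c = derive1 (F2 0) 0.
    by rewrite [RHS](@derive1_shiftl (fun s => g _ s _)) addr0 !mul0r !addr0.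
  apply: is_derive_increment.
    near=> z; have [|_ h _] := dU a (b + z.2) (c + z.1 * r).
      by near: z.
    exact: (@derivable_shiftl (fun s => g _ s _)).
  rewrite /prop_for /continuous_at [X in _ --> X]/=.
  rewrite [X in _ --> X](@derive1_shiftl (fun s => g _ s _)) addr0 !mul0r !addr0.
  under eq_fun do rewrite [X in X _]/= (@derive1_shiftl (fun s => g _ s _)).
  exact: (cvg_comp _ _ C2 cU2).
have D3 : is_derive (0 : R) 1 (fun e => F3 e (e * r) - F3 e 0) (r * pd3 g a b c).
  have -> : pd3 g a b c = derive1 (F3 0) 0.
    by rewrite [RHS](@derive1_shiftl (fun s => g _ _ s)) addr0.
  apply: is_derive_increment.
    near=> z; have [|_ _ h] := dU a b (c + z.2).
      by near: z.
    exact: (@derivable_shiftl (fun s => g _ _ s)).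
  rewrite /prop_for /continuous_at [X in _ --> X]/=.
  rewrite [X in _ --> X](@derive1_shiftl (fun s => g _ _ s)) addr0.
  under eq_fun do rewrite [X in X _]/= (@derive1_shiftl (fun s => g _ _ s)).
  exact: (cvg_comp _ _ C3 cU3).
have -> : (fun e => g (a + e * p) (b + e * q) (c + e * r)) =
    (fun e => (F1 e (e * p) - F1 e 0) + (F2 e (e * q) - F2 e 0) +
      (F3 e (e * r) - F3 e 0) + cst (g a b c) e).
  by apply/funext => e; rewrite /F1 /F2 /F3 /= !addr0; ring.
have := is_deriveD_fun (is_deriveD_fun (is_deriveD_fun D1 D2) D3)
  (is_derive_cst (g a b c) (0 : R) 1).
by rewrite addr0.
Unshelve. all: by end_near. Qed.

Lemma C1_nonneg_is_derive (h : R -> R) (a : R) : C1_nonneg h -> 0 <= a ->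
  is_derive a 1 h (derive1 h a).
Proof.
by move=> [U [_ Ua dU _]] a0; rewrite derive1E; apply/derivableP/dU/Ua.
Qed.

Lemma is_derive_line1 (h : R -> R) (a p : R) : C1_nonneg h -> 0 <= a ->
  is_derive (0 : R) 1 (fun e => h (a + e * p)) (p * derive1 h a).
Proof.
move=> hC1 a0; rewrite mulrC.
apply: (@is_derive1_comp _ h (fun e => a + e * p)).
  by rewrite mul0r addr0; exact: C1_nonneg_is_derive.
exact: is_derive_affine.
Qed.

Lemma is_derive_flux (chi : R -> R) (D a b x rx pxx rxx : R) (p p' r r' : R -> R) :
  C1_nonneg chi -> 0 <= a ->
  (forall s : R, is_derive s 1 p (p' s)) -> is_derive x 1 p' pxx ->
  is_derive x 1 r rx -> is_derive x 1 r' rxx ->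
  is_derive (0 : R) 1 (fun e => derive1 (fun s => D * (e * r' s) -
      (b + e * r s) * chi (a + e * p s) * (e * p' s)) x)
    (D * rxx - b * chi a * pxx).
Proof.
move=> chiC1 a0 dp dp' dr dr'.
have [U [oU Uge dU cU]] := chiC1.
pose B e := D * rxx - ((b + e * r x) * chi (a + e * p x) * pxx
   + p' x * (e * (rx * chi (a + e * p x)
   + (b + e * r x) * (p' x * derive1 chi (a + e * p x))))).
have -> : D * rxx - b * chi a * pxx = B 0 by rewrite /B !mul0r !addr0; ring.
have cE (y z : R) : {for 0, continuous (fun e : R => y + e * z)}.
  exact: (is_derive_continuous (is_derive_affine y z 0)).
have cE' : (fun e : R => a + e * p x) @ (0 : R) --> a.
  by have := cE a (p x); rewrite /prop_for /continuous_at mul0r addr0.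
have cchi : {for 0, continuous (fun e : R => chi (a + e * p x))}.
  exact: (is_derive_continuous (is_derive_line1 _ chiC1 a0)).
apply: is_derive_ideal.
  have cchi' : {for 0, continuous (fun e : R => derive1 chi (a + e * p x))}.
    rewrite /prop_for /continuous_at mul0r addr0.
    by apply: (cvg_comp _ _ cE'); apply: cU; exact: Uge.
  have cc (y : R) : {for 0, continuous (cst y : R -> R)} by exact: cvg_cst.
  have cid : {for 0, continuous (@idfun R)} by exact: cvg_id.
  exact: (continuousB (cc (D * rxx)) (continuousD (continuousM
   (continuousM (cE b (r x)) cchi) (cc pxx)) (continuousM (cc (p' x))
   (continuousM cid (continuousD (continuousM (cc rx) cchi)
    (continuousM (cE b (r x)) (continuousM (cc (p' x)) cchi'))))))).
near=> e; apply: is_derive_derive1.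
have Ue : U (a + e * p x).
  near: e; apply: cE'; apply: open_nbhs_nbhs; split => //; exact: Uge.
have dchi : is_derive (a + e * p x) 1 chi (derive1 chi (a + e * p x)).
  by rewrite derive1E; apply/derivableP/dU.
have aff (y z : R) (f : R -> R) : is_derive x 1 f z ->
    is_derive x 1 (fun s => y + e * f s) (e * z).
  move=> fz; rewrite -[e * z]add0r.
  exact: (is_deriveD_fun (is_derive_cst y x 1) (is_deriveMl_fun e fz)).
have H := is_deriveB_fun (is_deriveMl_fun D (is_deriveMl_fun e dr'))
  (is_deriveM_fun (is_deriveM_fun (aff b rx r dr)
    (@is_derive1_comp _ chi (fun s => a + e * p s) _ _ _ dchi (aff a _ p (dp x))))
    (is_deriveMl_fun e dp')).
apply: (is_derive_eq H); rewrite /B /=; ring.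
Unshelve. all: by end_near. Qed.

End Line.

Section Modes.
Variable R : realType.
Implicit Types (C sigma : R[i]) (k x : R * R) (t : R).

Definition re_mode C sigma k t x : R := complex.Re (mode C sigma k t x).

Lemma is_derive_Re_cexp C (al be : R -> R) (s a b : R) :
  is_derive s 1 al a -> is_derive s 1 be b ->
  is_derive s 1 (fun s => complex.Re (C * cexp (Complex (al s) (be s))))
    (complex.Re (C * Complex a b * cexp (Complex (al s) (be s)))).
Proof.
case: C => c d da db; rewrite /cexp /=.
have De := @is_derive1_comp _ expR al _ _ _ (is_derive_expR (al s)) da.
have Dc := @is_derive1_comp _ cos be _ _ _ (is_derive_cos (be s)) db.
have Ds := @is_derive1_comp _ sin be _ _ _ (is_derive_sin (be s)) db.
have H := is_deriveB_fun (is_deriveMl_fun c (is_deriveM_fun De Dc))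
  (is_deriveMl_fun d (is_deriveM_fun De Ds)).
by apply: (is_derive_eq H) => /=; ring.
Qed.

Lemma modeE C sigma k t x : mode C sigma k t x =
  C * cexp (Complex (complex.Re sigma * t)
    (complex.Im sigma * t + (k.1 * x.1 + k.2 * x.2))).
Proof.
rewrite /mode; suff -> : sigma * t%:C%C + Complex 0 (k.1 * x.1 + k.2 * x.2) =
    Complex (complex.Re sigma * t)
      (complex.Im sigma * t + (k.1 * x.1 + k.2 * x.2)) by [].
case: sigma => a b; apply/eqP; rewrite eq_complex /=.
by apply/andP; split; apply/eqP; ring.
Qed.

Lemma is_derive_re_mode_t C sigma k t x :
  is_derive t 1 (fun s => re_mode C sigma k s x) (re_mode (C * sigma) sigma k t x).
Proof.
rewrite /re_mode modeE; under eq_fun do rewrite modeE.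
have lin (a b : R) : is_derive t 1 (fun s => a * s + b) a.
  have := is_derive_affine b a t; congr (is_derive t 1 _ _).
  by apply/funext => s; rewrite addrC mulrC.
have H := is_derive_Re_cexp C (lin (complex.Re sigma) 0)
  (lin (complex.Im sigma) (k.1 * x.1 + k.2 * x.2)).
have sE : Complex (complex.Re sigma) (complex.Im sigma) = sigma by case: (sigma).
move: H; rewrite sE addr0; congr (is_derive t 1 _ _).
by apply/funext => s; rewrite addr0.
Qed.

Lemma is_derive_re_mode_1 C sigma k t (y s : R) :
  is_derive s 1 (fun s => re_mode C sigma k t (s, y))
    (re_mode (C * Complex 0 k.1) sigma k t (s, y)).
Proof.
rewrite /re_mode modeE; under eq_fun do rewrite modeE.
have lin : is_derive s 1
    (fun s => complex.Im sigma * t + (k.1 * s + k.2 * y)) k.1.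
  have := is_derive_affine (complex.Im sigma * t + k.2 * y) k.1 s.
  by congr (is_derive s 1 _ _); apply/funext => z; ring.
exact: (is_derive_Re_cexp C (is_derive_cst (complex.Re sigma * t) s 1) lin).
Qed.

Lemma is_derive_re_mode_2 C sigma k t (y s : R) :
  is_derive s 1 (fun s => re_mode C sigma k t (y, s))
    (re_mode (C * Complex 0 k.2) sigma k t (y, s)).
Proof.
rewrite /re_mode modeE; under eq_fun do rewrite modeE.
have lin : is_derive s 1
    (fun s => complex.Im sigma * t + (k.1 * y + k.2 * s)) k.2.
  have := is_derive_affine (complex.Im sigma * t + k.1 * y) k.2 s.
  by congr (is_derive s 1 _ _); apply/funext => z; ring.
exact: (is_derive_Re_cexp C (is_derive_cst (complex.Re sigma * t) s 1) lin).
Qed.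

End Modes.

Section Linearization.
Local Open Scope complex_scope.
Variable R : realType.
Implicit Types (C sigma : R[i]) (k x : R * R) (t : R).

Lemma ddx1_perturb (a e : R) C sigma k t x :
  ddx1 (perturb a e (re_mode C sigma k) t) x =
  e * re_mode (C * Complex 0 k.1) sigma k t x.
Proof.
case: x => x y; apply: is_derive_derive1; rewrite -[X in is_derive _ _ _ X]add0r.
exact: (is_deriveD_fun (is_derive_cst a x 1)
  (is_deriveMl_fun e (is_derive_re_mode_1 C sigma k t y x))).
Qed.

Lemma ddx2_perturb (a e : R) C sigma k t x :
  ddx2 (perturb a e (re_mode C sigma k) t) x =
  e * re_mode (C * Complex 0 k.2) sigma k t x.
Proof.
case: x => x y; apply: is_derive_derive1; rewrite -[X in is_derive _ _ _ X]add0r.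
exact: (is_deriveD_fun (is_derive_cst a y 1)
  (is_deriveMl_fun e (is_derive_re_mode_2 C sigma k t x y))).
Qed.

Lemma ddt_perturb (a e : R) C sigma k t x :
  ddt (perturb a e (re_mode C sigma k)) t x = e * re_mode (C * sigma) sigma k t x.
Proof.
apply: is_derive_derive1; rewrite -[X in is_derive _ _ _ X]add0r.
exact: (is_deriveD_fun (is_derive_cst a t 1)
  (is_deriveMl_fun e (is_derive_re_mode_t C sigma k t x))).
Qed.

Definition sqnorm k : R := k.1 ^+ 2 + k.2 ^+ 2.

Lemma laplacian_perturb (a e : R) C sigma k t x :
  laplacian (perturb a e (re_mode C sigma k) t) x =
  e * (- sqnorm k * re_mode C sigma k t x).
Proof.
have fstE C' y : e * re_mode C' sigma k t y =
    perturb 0 e (re_mode C' sigma k) t y by rewrite /perturb add0r.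
rewrite /laplacian /diverg.
have -> : (fun y => (grad (perturb a e (re_mode C sigma k) t) y).1) =
    perturb 0 e (re_mode (C * Complex 0 k.1) sigma k) t.
  by apply/funext => y; rewrite /= ddx1_perturb fstE.
have -> : (fun y => (grad (perturb a e (re_mode C sigma k) t) y).2) =
    perturb 0 e (re_mode (C * Complex 0 k.2) sigma k) t.
  by apply/funext => y; rewrite /= ddx2_perturb fstE.
rewrite ddx1_perturb ddx2_perturb -mulrDr /re_mode !modeE /sqnorm.
by case: C (cexp _) => c d [? ?] /=; ring.
Qed.

Lemma is_derive_diverg_flux (chi : R -> R) (D a b : R) C C' sigma k t x :
  C1_nonneg chi -> 0 <= a ->
  is_derive (0 : R) 1 (fun e => diverg (fun y =>
      D *: grad (perturb b e (re_mode C' sigma k) t) y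
      - (perturb b e (re_mode C' sigma k) t y
         * chi (perturb a e (re_mode C sigma k) t y))
        *: grad (perturb a e (re_mode C sigma k) t) y) x)
    (sqnorm k * (b * chi a * re_mode C sigma k t x - D * re_mode C' sigma k t x)).
Proof.
move=> chiC1 a0; case: x => x y.
have H1 := is_derive_flux D b chiC1 a0
  (is_derive_re_mode_1 C sigma k t y) (is_derive_re_mode_1 _ sigma k t y x)
  (is_derive_re_mode_1 C' sigma k t y x)
  (is_derive_re_mode_1 (C' * Complex 0 k.1) sigma k t y x).
have H2 := is_derive_flux D b chiC1 a0
  (is_derive_re_mode_2 C sigma k t x) (is_derive_re_mode_2 _ sigma k t x y)
  (is_derive_re_mode_2 C' sigma k t x y)
  (is_derive_re_mode_2 (C' * Complex 0 k.2) sigma k t x y).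
have := is_deriveD_fun H1 H2; congr (is_derive _ _ _ _).
  apply/funext => e; rewrite /diverg; congr (_ + _).
    apply: (congr1 (fun h : R -> R => derive1 h x)); apply/funext => s.
    by rewrite /= !ddx1_perturb.
  apply: (congr1 (fun h : R -> R => derive1 h y)); apply/funext => s.
  by rewrite /= !ddx2_perturb.
move=> {H1 H2}; rewrite /re_mode !modeE /sqnorm.
by case: C C' (cexp _) => [? ?] [? ?] [? ?] /=; ring.
Qed.

Variables (S : tpg_system R) (ubar wbar : R).
Hypotheses (hS : tpg_admissible S) (u0 : 0 <= ubar) (w0 : 0 <= wbar).

Definition lin_uu : R := derive1 (h1 S) ubar - g1 S ubar 0 wbar
  - ubar * pd1 (g1 S) ubar 0 wbar.
Definition lin_uv : R := ubar * (gamma S * f S ubar 0 wbar - pd2 (g1 S) ubar 0 wbar).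
Definition lin_uw : R := ubar * pd3 (g1 S) ubar 0 wbar.
Definition lin_vv : R := h2 S 0 - ubar * f S ubar 0 wbar - g2 S ubar 0 wbar.
Definition taxis_w : R := wbar * chi2 S ubar.

Definition mode_eq_u k sigma C1 C2 C3 : R[i] :=
  (sigma + (D_u S * sqnorm k - lin_uu)%:C) * C1 - lin_uv%:C * C2 + lin_uw%:C * C3.
Definition mode_eq_v k sigma C2 : R[i] :=
  (sigma + (D_v S * sqnorm k - lin_vv)%:C) * C2.
Definition mode_eq_w k sigma C1 C3 : R[i] :=
  (sigma + (D_w S * sqnorm k)%:C) * C3 - (taxis_w * sqnorm k)%:C * C1.

Lemma is_derive_residual_u C1 C2 C3 sigma k t x :
  is_derive (0 : R) 1 (fun eps => residual_u S
    (perturb ubar eps (re_mode C1 sigma k)) (perturb 0 eps (re_mode C2 sigma k))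
    (perturb wbar eps (re_mode C3 sigma k)) t x)
    (re_mode (mode_eq_u k sigma C1 C2 C3) sigma k t x).
Proof.
have [_ _ [fC1 g1C1 _] [h1C1 _ _ _]] := hS.
set p := re_mode C1 sigma k t x; set q := re_mode C2 sigma k t x.
set r := re_mode C3 sigma k t x.
have df := is_derive_line p q r fC1 u0 (lexx 0) w0.
have dg := is_derive_line p q r g1C1 u0 (lexx 0) w0.
have dh := is_derive_line1 p h1C1 u0.
have H := is_deriveB_fun (is_derive_mulr 0 (re_mode (C1 * sigma) sigma k t x))
  (is_deriveD_fun (is_deriveD_fun
    (is_deriveMl_fun (D_u S) (is_derive_mulr 0 (- sqnorm k * p)))
    (is_deriveM_fun (is_derive_affine ubar p 0)
      (is_deriveB_fun (is_deriveM_fun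
        (is_deriveMl_fun (gamma S) (is_derive_affine 0 q 0)) df) dg))) dh).
move: H; congr (is_derive _ _ _ _).
  by apply/funext => e; rewrite /residual_u ddt_perturb laplacian_perturb.
rewrite /= !mul0r !addr0 /mode_eq_u /lin_uu /lin_uv /lin_uw /p /q /r /re_mode !modeE.
move=> {p q r df dg dh}.
by case: C1 C2 C3 sigma (cexp _) => [? ?] [? ?] [? ?] [? ?] [? ?] /=; ring.
Qed.

Lemma is_derive_residual_v C1 C2 C3 sigma k t x :
  is_derive (0 : R) 1 (fun eps => residual_v S
    (perturb ubar eps (re_mode C1 sigma k)) (perturb 0 eps (re_mode C2 sigma k))
    (perturb wbar eps (re_mode C3 sigma k)) t x)
    (re_mode (mode_eq_v k sigma C2) sigma k t x).
Proof.
have [_ _ [fC1 _ g2C1] [_ h2C1 chi1C1 _]] := hS.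
set p := re_mode C1 sigma k t x; set q := re_mode C2 sigma k t x.
set r := re_mode C3 sigma k t x.
have df := is_derive_line p q r fC1 u0 (lexx 0) w0.
have dg := is_derive_line p q r g2C1 u0 (lexx 0) w0.
have dh := is_derive_line1 q h2C1 (lexx 0).
have H := is_deriveB_fun (is_derive_mulr 0 (re_mode (C2 * sigma) sigma k t x))
  (is_deriveD_fun 
    (is_derive_diverg_flux (D_v S) 0 C1 C2 sigma k t x chi1C1 u0)
    (is_deriveM_fun (is_derive_affine 0 q 0)
      (is_deriveD_fun (is_deriveB_fun (is_deriveM_fun
        (is_deriveN_fun (is_derive_affine ubar p 0)) df) dg) dh))).
move: H; congr (is_derive _ _ _ _).
  by apply/funext => e; rewrite /residual_v ddt_perturb.
rewrite /= !mul0r !addr0 /mode_eq_v /lin_vv /p /q /r /re_mode !modeE.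
move=> {p q r df dg dh}.
by case: C1 C2 C3 sigma (cexp _) => [? ?] [? ?] [? ?] [? ?] [? ?] /=; ring.
Qed.

Lemma is_derive_residual_w C1 C3 sigma k t x :
  is_derive (0 : R) 1 (fun eps => residual_w S
    (perturb ubar eps (re_mode C1 sigma k))
    (perturb wbar eps (re_mode C3 sigma k)) t x)
    (re_mode (mode_eq_w k sigma C1 C3) sigma k t x).
Proof.
have [_ _ _ [_ _ _ chi2C1]] := hS.
have H := is_deriveB_fun (is_derive_mulr 0 (re_mode (C3 * sigma) sigma k t x))
    (is_derive_diverg_flux (D_w S) wbar C1 C3 sigma k t x chi2C1 u0).
move: H; congr (is_derive _ _ _ _).
  by apply/funext => e; rewrite /residual_w ddt_perturb.
rewrite /mode_eq_w /taxis_w /re_mode !modeE.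
by case: C1 C3 sigma (cexp _) => [? ?] [? ?] [? ?] [? ?] /=; ring.
Qed.

End Linearization.

Section GrowthRates.
Local Open Scope complex_scope.
Variable R : realType.
Implicit Types (C sigma : R[i]) (k x : R * R) (t : R).

Lemma sqnorm_gt0 k : k != 0 -> 0 < sqnorm k.
Proof.
move=> k0; rewrite lt_def /sqnorm addr_ge0 ?sqr_ge0 // andbT.
rewrite paddr_eq0 ?sqr_ge0 // !sqrf_eq0; apply: contra k0 => /andP[/eqP k1 /eqP k2].
by apply/eqP; rewrite [k]surjective_pairing k1 k2.
Qed.

Lemma cexp_neq0 (z : R[i]) : cexp z != 0.
Proof.
rewrite eq_complex /= !mulf_eq0 !(gt_eqF (expR_gt0 _)) /=.
apply/negP => /andP[/eqP c0 /eqP s0].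
have := cos2Dsin2 (complex.Im z); rewrite c0 s0 expr0n addr0 => /eqP.
by rewrite eq_sym oner_eq0.
Qed.

Lemma Im_mode C sigma k t x :
  complex.Im (mode C sigma k t x) = re_mode (C * Complex 0 (-1)) sigma k t x.
Proof. by rewrite /re_mode !modeE; case: C (cexp _) => [? ?] [? ?] /=; ring. Qed.

Lemma re_mode_eq0 C sigma k t x : re_mode C sigma k t x = 0 ->
  re_mode (C * Complex 0 (-1)) sigma k t x = 0 -> C = 0.
Proof.
rewrite -Im_mode /re_mode => re0 im0.
have : mode C sigma k t x = 0 by apply/eqP; rewrite eq_complex re0 im0 /= eqxx.
by move=> /eqP; rewrite /mode mulf_eq0 (negbTE (cexp_neq0 _)) orbF => /eqP.
Qed.

Lemma re_mode0 sigma k t x : re_mode 0 sigma k t x = 0.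
Proof. by rewrite /re_mode /mode mul0r. Qed.

Variables (S : tpg_system R) (ubar wbar : R).
Hypotheses (hS : tpg_admissible S) (u0 : 0 <= ubar) (w0 : 0 <= wbar).

Local Notation eq_u := (mode_eq_u S ubar wbar).
Local Notation eq_v := (mode_eq_v S ubar wbar).
Local Notation eq_w := (mode_eq_w S ubar wbar).

Lemma mode_eq_uM k sigma C1 C2 C3 C :
  eq_u k sigma (C1 * C) (C2 * C) (C3 * C) = eq_u k sigma C1 C2 C3 * C.
Proof. by rewrite /mode_eq_u; ring. Qed.

Lemma mode_eq_vM k sigma C2 C : eq_v k sigma (C2 * C) = eq_v k sigma C2 * C.
Proof. by rewrite /mode_eq_v; ring. Qed.

Lemma mode_eq_wM k sigma C1 C3 C :
  eq_w k sigma (C1 * C) (C3 * C) = eq_w k sigma C1 C3 * C.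
Proof. by rewrite /mode_eq_w; ring. Qed.

Lemma growth_rateP (Omega : set (R * R)) k sigma : Omega !=set0 ->
  growth_rate S Omega ubar 0 wbar k sigma <->
  exists C1 C2 C3, [/\ ~ [/\ C1 = 0, C2 = 0 & C3 = 0],
    eq_u k sigma C1 C2 C3 = 0, eq_v k sigma C2 = 0 & eq_w k sigma C1 C3 = 0].
Proof.
move=> [x Ox].
have ImE C : (fun t x => complex.Im (mode C sigma k t x)) =
    re_mode (C * Complex 0 (-1)) sigma k.
  by apply/funext => t; apply/funext => y; exact: Im_mode.
have uniq (h : R -> R) (a b : R) :
    is_derive (0 : R) 1 h a -> is_derive (0 : R) 1 h b -> a = b.
  by move=> ha hb; rewrite -(is_derive_derive1 ha) (is_derive_derive1 hb).
split=> [[C1 [C2 [C3 [nz re]]]]|[C1 [C2 [C3 [nz hu hv hw]]]]].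
  rewrite !ImE => im; exists C1, C2, C3.
  have [ru rv rw] := re 1 x ltr01 Ox.
  have [iu iv iw] := im 1 x ltr01 Ox.
  split=> //.
  - apply: (@re_mode_eq0 _ sigma k 1 x).
      exact: (uniq _ _ _ (is_derive_residual_u hS u0 w0 C1 C2 C3 sigma k 1 x) ru).
    rewrite -mode_eq_uM.
    exact: (uniq _ _ _ (is_derive_residual_u hS u0 w0 _ _ _ sigma k 1 x) iu).
  - apply: (@re_mode_eq0 _ sigma k 1 x).
      exact: (uniq _ _ _ (is_derive_residual_v hS u0 w0 C1 C2 C3 sigma k 1 x) rv).
    rewrite -mode_eq_vM.
    exact: (uniq _ _ _ (is_derive_residual_v hS u0 w0 _ _ _ sigma k 1 x) iv).
  - apply: (@re_mode_eq0 _ sigma k 1 x).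
      exact: (uniq _ _ _ (is_derive_residual_w wbar hS u0 C1 C3 sigma k 1 x) rw).
    rewrite -mode_eq_wM.
    exact: (uniq _ _ _ (is_derive_residual_w wbar hS u0 _ _ sigma k 1 x) iw).
have sol D1 D2 D3 : eq_u k sigma D1 D2 D3 = 0 -> eq_v k sigma D2 = 0 ->
    eq_w k sigma D1 D3 = 0 -> solves_linearized S Omega ubar 0 wbar
      (re_mode D1 sigma k) (re_mode D2 sigma k) (re_mode D3 sigma k).
  move=> eu ev ew t y _ _; split.
  - by have := is_derive_residual_u hS u0 w0 D1 D2 D3 sigma k t y;
    rewrite eu re_mode0.
  - by have := is_derive_residual_v hS u0 w0 D1 D2 D3 sigma k t y;
    rewrite ev re_mode0.
  - by have := is_derive_residual_w wbar hS u0 D1 D3 sigma k t y;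
    rewrite ew re_mode0.
exists C1, C2, C3; split=> //; first exact: sol.
rewrite !ImE; apply: sol.
- by rewrite mode_eq_uM hu mul0r.
- by rewrite mode_eq_vM hv mul0r.
- by rewrite mode_eq_wM hw mul0r.
Qed.

Lemma Re_root_quadratic (a1 a0 : R) sigma : 0 < a1 -> 0 < a0 ->
  sigma * sigma + a1%:C * sigma + a0%:C = 0 -> complex.Re sigma < 0.
Proof.
case: sigma => s y a1_gt0 a0_gt0 /eqP; rewrite eq_complex /=.
move=> /andP[/eqP re /eqP im].
have /eqP : y * (2 * s + a1) = 0 by rewrite -[RHS]im; ring.
rewrite mulf_eq0 => /orP[/eqP y0|/eqP ?]; last by lra.
rewrite y0 in re; rewrite ltNge; apply/negP => s0.
by nra.
Qed.

(* The larger real root exceeds every point where the quadratic is negative. *)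
Lemma exists_pos_root (a1 a0 s : R) : 0 <= s -> s ^+ 2 + a1 * s + a0 < 0 ->
  exists2 y : R, 0 < y & y ^+ 2 + a1 * y + a0 = 0.
Proof.
move=> s0 neg; pose d := a1 ^+ 2 - 4 * a0.
have d0 : (2 * s + a1) ^+ 2 < d by rewrite /d; nra.
have d_ge0 : 0 <= d by rewrite (le_trans (sqr_ge0 _) (ltW d0)).
have sq := sqr_sqrtr d_ge0; have sq0 := sqrtr_ge0 d.
exists ((- a1 + Num.sqrt d) / 2).
  have : 2 * s + a1 < Num.sqrt d.
    by rewrite ltNge; apply/negP => le; nra.
  by lra.
rewrite /d in sq *; set z := Num.sqrt _ in sq *.
have -> : ((- a1 + z) / 2) ^+ 2 + a1 * ((- a1 + z) / 2) + a0 =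
  (z ^+ 2 - (a1 ^+ 2 - 4 * a0)) / 4 by field.
by rewrite sq subrr mul0r.
Qed.

Local Notation Auu := (lin_uu S ubar wbar).
Local Notation Auw := (lin_uw S ubar wbar).
Local Notation Avv := (lin_vv S ubar wbar).
Local Notation Tw := (taxis_w S ubar wbar).

Lemma eliminate_C3 (a b c d : R) (sigma C1 C3 : R[i]) :
  (sigma * sigma + (a + b)%:C * sigma + (a * b + c * d)%:C) * C1 =
  (sigma + b%:C) * ((sigma + a%:C) * C1 + c%:C * C3)
  - c%:C * ((sigma + b%:C) * C3 - d%:C * C1).
Proof.
case: sigma C1 C3 => [? ?] [? ?] [? ?].
by apply/eqP; rewrite eq_complex /=; apply/andP; split; apply/eqP; ring.
Qed.

Lemma stable_growth_rate k sigma C1 C2 C3 : k != 0 ->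
  Avv < 0 -> Auu < Num.min (Auw * Tw / D_w S) 0 ->
  ~ [/\ C1 = 0, C2 = 0 & C3 = 0] ->
  eq_u k sigma C1 C2 C3 = 0 -> eq_v k sigma C2 = 0 -> eq_w k sigma C1 C3 = 0 ->
  complex.Re sigma < 0.
Proof.
move=> k0 vv; rewrite lt_min ltr_pdivlMr ?(andP _).1; last by case: hS => -[].
have [[Du0 Dv0 Dw0 _] _ _ _] := hS.
move=> /andP[uuw uu] nz.
have K0 := sqnorm_gt0 k0.
have neg (a : R) : 0 < a -> sigma + a%:C = 0 -> complex.Re sigma < 0.
  by move=> a0; case: (sigma) => s y [] /=; lra.
rewrite /mode_eq_u /mode_eq_v /mode_eq_w.
set K := sqnorm k in K0 *.
have [C20|C2n0] := eqVneq C2 0; last first.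
  move=> _ /eqP; rewrite mulf_eq0 (negbTE C2n0) orbF => /eqP + _; apply: neg.
  by have := mulr_gt0 Dv0 K0; lra.
rewrite C20 mulr0 subr0 => hu _ hw.
have [C10|C1n0] := eqVneq C1 0.
  have C3n0 : C3 != 0 by apply/eqP => C30; apply: nz; split.
  move: hw; rewrite C10 mulr0 subr0 => /eqP.
  rewrite mulf_eq0 (negbTE C3n0) orbF => /eqP; apply: neg; exact: mulr_gt0.
apply: (@Re_root_quadratic (D_u S * K - Auu + D_w S * K)
   ((D_u S * K - Auu) * (D_w S * K) + Auw * (Tw * K))).
- by have := mulr_gt0 Du0 K0; have := mulr_gt0 Dw0 K0; lra.
- have -> : (D_u S * K - Auu) * (D_w S * K) + Auw * (Tw * K) =
    K * (D_u S * D_w S * K + (Auw * Tw - Auu * D_w S)) by ring.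
  by rewrite mulr_gt0 // addr_gt0 ?mulr_gt0 // subr_gt0.
apply: (mulIf C1n0); rewrite mul0r.
by rewrite (eliminate_C3 _ _ _ _ _ _ C3) hu hw !mulr0 subr0.
Qed.

Lemma exists_unstable_mode : 
  0 < Avv \/ Num.min (Auw * Tw / D_w S) 0 < Auu ->
  exists (k : R * R) (sigma : R) (C1 C2 C3 : R[i]),
  [/\ k != 0, 0 < sigma & [/\ ~ [/\ C1 = 0, C2 = 0 & C3 = 0],
    eq_u k sigma%:C C1 C2 C3 = 0, eq_v k sigma%:C C2 = 0 &
    eq_w k sigma%:C C1 C3 = 0]].
Proof.
have [[Du0 Dv0 Dw0 _] _ _ _] := hS.
have getk (K : R) : 0 < K -> exists2 k : R * R, k != 0 & sqnorm k = K.
  move=> K0; exists (Num.sqrt K, 0).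
    apply/eqP => -[] /eqP; rewrite gt_eqF // sqrtr_gt0 //.
  by rewrite /sqnorm /= expr0n addr0 sqr_sqrtr // ltW.
pose Q k s := (s + (D_u S * sqnorm k - Auu)) * (s + D_w S * sqnorm k)
  + Auw * (Tw * sqnorm k).
have root_mode k s : k != 0 -> 0 < s -> Q k s = 0 ->
    exists C1 C3 : R[i],
      [/\ C1 <> 0, eq_u k s%:C C1 0 C3 = 0 & eq_w k s%:C C1 C3 = 0].
  move=> k0 s0 Qs.
  exists (s + D_w S * sqnorm k)%:C, (Tw * sqnorm k)%:C; split.
  - by move=> [] /eqP; rewrite gt_eqF // addr_gt0 // mulr_gt0 // sqnorm_gt0.
  - apply/eqP; rewrite eq_complex /mode_eq_u /=; apply/andP; split;
      apply/eqP; last by ring.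
    by rewrite -[RHS]Qs /Q; ring.
  - apply/eqP; rewrite eq_complex /mode_eq_w /=; apply/andP; split; apply/eqP; ring.
case=> [vv|uu].
  have [k k0 kE] : exists2 k : R * R, k != 0 & sqnorm k = Avv / (2 * D_v S).
    by apply: getk; rewrite divr_gt0 ?mulr_gt0.
  pose s := Avv / 2.
  have s0 : 0 < s by rewrite divr_gt0.
  have ev C2 : eq_v k s%:C C2 = 0.
    rewrite /mode_eq_v kE -rmorphD /=.
    have -> : s + (D_v S * (Avv / (2 * D_v S)) - Avv) = 0.
      by rewrite /s; field; rewrite gt_eqF.
    by rewrite mul0r.
  have [Q0|Qn0] := eqVneq (Q k s) 0.
    have [C1 [C3 [C10 eu ew]]] := root_mode k s k0 s0 Q0.
    by exists k, s, C1, 0, C3; split=> //; split=> // -[].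
  set B := lin_uv S ubar wbar; pose q := (Q k s)^-1.
  have qE : Q k s * q = 1 by rewrite mulfV.
  exists k, s, (B * (s + D_w S * sqnorm k) * q)%:C, 1, (B * (Tw * sqnorm k) * q)%:C.
  split=> //; split=> //.
  - by case=> _ /eqP; rewrite oner_eq0.
  - apply/eqP; rewrite eq_complex /mode_eq_u /=; apply/andP; split;
      apply/eqP; last by ring.
    rewrite -/B; transitivity (B * (Q k s * q) - B); last by rewrite qE mulr1 subrr.
    by rewrite /Q; ring.
  - apply/eqP; rewrite eq_complex /mode_eq_w /=; apply/andP; split; apply/eqP; ring.
suff [K [s [K0 s0 neg]]] : exists K s : R, [/\ 0 < K, 0 <= s &
    s ^+ 2 + (D_u S * K - Auu + D_w S * K) * s +
    ((D_u S * K - Auu) * (D_w S * K) + Auw * (Tw * K)) < 0].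
  have [k k0 kE] := getk K K0.
  have [y y0 yE] := exists_pos_root s0 neg.
  have Qy : Q k y = 0 by rewrite -yE /Q kE; ring.
  have [C1 [C3 [C10 eu ew]]] := root_mode k y k0 y0 Qy.
  exists k, y, C1, 0, C3; split=> //; split=> //; first by case.
  by rewrite /mode_eq_v mulr0.
move: uu; rewrite gt_min ltr_pdivrMr // => /orP[uw|uu].
  exists ((Auu * D_w S - Auw * Tw) / (2 * (D_u S * D_w S))), 0; split=> //.
    by rewrite divr_gt0 ?subr_gt0 // !mulr_gt0.
  set K := _ / _.
  have K0 : 0 < K by rewrite divr_gt0 ?subr_gt0 // !mulr_gt0.
  rewrite expr0n /= mulr0 !add0r.
  have -> : (D_u S * K - Auu) * (D_w S * K) + Auw * (Tw * K) =
      - (K * (K * (D_u S * D_w S))).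
    have KE : K * (D_u S * D_w S) *+ 2 = Auu * D_w S - Auw * Tw.
      by rewrite /K; field; rewrite !gt_eqF.
    have -> : (D_u S * K - Auu) * (D_w S * K) + Auw * (Tw * K) =
      K * (K * (D_u S * D_w S) - (Auu * D_w S - Auw * Tw)) by ring.
    by rewrite -KE; ring.
  by rewrite oppr_lt0 mulr_gt0 // mulr_gt0 // mulr_gt0.
pose L := (D_u S + D_w S) * (Auu / 2) - Auu * D_w S + Auw * Tw.
pose m := `|L| + D_u S * D_w S.
have P0 : 0 < D_u S * D_w S by rewrite mulr_gt0.
have m0 : 0 < m by rewrite ltr_wpDl.
have A0 : 0 < Auu ^+ 2 by rewrite exprn_gt0.
have d0 : 0 < 4 * m + Auu ^+ 2 by rewrite addr_gt0 // mulr_gt0.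
exists (Auu ^+ 2 / (4 * m + Auu ^+ 2)), (Auu / 2).
set K := _ / _.
have K0 : 0 < K by rewrite divr_gt0.
have K1 : K <= 1 by rewrite ler_pdivrMr // mul1r lerDr mulr_ge0 // ltW.
split=> //; first by rewrite divr_ge0 // ltW.
have Km : K * (4 * m) < Auu ^+ 2.
  have <- : K * (4 * m + Auu ^+ 2) = Auu ^+ 2 by rewrite divfK // gt_eqF.
  by rewrite ltr_pM2l // ltrDl.
have KL : K * L <= K * `|L| by rewrite ler_pM2l // ler_norm.
have KP : K * (K * (D_u S * D_w S)) <= K * (D_u S * D_w S).
  by rewrite ler_pM2l // ler_piMl // ltW.
have -> : (Auu / 2) ^+ 2 + (D_u S * K - Auu + D_w S * K) * (Auu / 2) +
    ((D_u S * K - Auu) * (D_w S * K) + Auw * (Tw * K)) =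
    - (Auu ^+ 2 / 4) + K * L + K * (K * (D_u S * D_w S)) by rewrite /L; field.
have : K * m = K * `|L| + K * (D_u S * D_w S) by rewrite /m mulrDr.
by lra.
Qed.

End GrowthRates.

Theorem proposition3p1 (R : realType) (Omega : set (R * R))
    (S : tpg_system R) (u0 v0 w0 : R * R -> R) (ubar wbar : R)
    (hOmega : bounded_domain Omega)
    (hbdry : piecewise_smooth_boundary Omega)
    (hS : tpg_admissible S)
    (hu0 : forall x, Omega x -> 0 <= u0 x)
    (hv0 : forall x, Omega x -> 0 <= v0 x)
    (hw0 : forall x, Omega x -> 0 <= w0 x)
    (hw0_int : ((@lebesgue_measure R) \x (@lebesgue_measure R))%E.-integrable
                 Omega (EFin \o w0))
    (hwbar : wbar = mean Omega w0)
    (hubar_ge0 : 0 <= ubar)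
    (hubar : - ubar * g1 S ubar 0 wbar + h1 S ubar = 0) :
  let lhs1 := ubar * f S ubar 0 wbar + g2 S ubar 0 wbar in
  let rhs1 := h2 S 0 in
  let lhs2 := g1 S ubar 0 wbar + ubar * pd1 (g1 S) ubar 0 wbar
    + Num.min (ubar * wbar * chi2 S ubar / D_w S * pd3 (g1 S) ubar 0 wbar) 0 in
  let rhs2 := derive1 (h1 S) ubar in
  (lhs1 > rhs1 /\ lhs2 > rhs2 -> asymptotically_stable S Omega ubar 0 wbar) /\
  (lhs1 < rhs1 \/ lhs2 < rhs2 -> unstable S Omega ubar 0 wbar).
Proof.
move=> lhs1 rhs1 lhs2 rhs2.
have wbar0 : 0 <= wbar.
  rewrite hwbar /mean; apply: mulr_ge0; first exact: Rintegral_ge0.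
  by rewrite invr_ge0; apply: fine_ge0; exact: measure_ge0.
have [x Ox] : Omega !=set0 by case: hOmega.
have ME : ubar * wbar * chi2 S ubar / D_w S * pd3 (g1 S) ubar 0 wbar =
    lin_uw S ubar wbar * taxis_w S ubar wbar / D_w S.
  by rewrite /lin_uw /taxis_w; ring.
rewrite /lhs1 /rhs1 /lhs2 /rhs2 ME; split=> [[lt1 lt2] k sigma k0|lt12].
  move=> /(growth_rateP hS hubar_ge0 wbar0 k sigma (ex_intro _ x Ox)).
  move=> [C1 [C2 [C3 [nz eu ev ew]]]].
  apply: (stable_growth_rate hS k0 _ _ nz eu ev ew); rewrite /lin_vv /lin_uu.
    by lra.
  by set M := Num.min _ _ in lt2 *; lra.
have [|k [sigma [C1 [C2 [C3 [k0 s0 sol]]]]]] :=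
    @exists_unstable_mode R S ubar wbar hS.
  rewrite /lin_vv /lin_uu; case: lt12 => [lt1|lt2]; [left|right]; first by lra.
  by set M := Num.min _ _ in lt2 *; lra.
exists k, sigma%:C%C; split=> //.
apply/(growth_rateP hS hubar_ge0 wbar0 k _ (ex_intro _ x Ox)).
by exists C1, C2, C3.
Qed.
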